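(* Let $f, g \in \mathcal{S}'(\mathbb{T})$ and $\lambda \neq 0$ a scalar. (1) For any $0 < p \leq \infty$, $s_{\lambda f}(p) = s_f(p)$. (2) If $f$ and $g$ are such that $s_f(p) \neq s_g(p)$ for some $0 < p \leq \infty$, then, for this $p$, $s_{f+g}(p) = \min(s_f(p) , s_g(p))$. (3) If $f$ and $g$ are such that $s_f(p) = s_g(p)$ for at most countably many $0 < p \leq \infty$, then $s_{f+g} = \min(s_f, s_g)$ (as functions on $(0,\infty]$).
   Context: $\mathbb{T} = \mathbb{R}/\mathbb{Z}$ is the one-dimensional torus, $\mathcal{S}(\mathbb{T})$ is the space of infinitely smooth periodic functions with its usual Fréchet topology, and $\mathcal{S}'(\mathbb{T})$ is its topological dual. $(\widehat{f}_k)_{k\in\mathbb{Z}}$ denotes the Fourier coefficients of $f \in \mathcal{S}'(\mathbb{T})$ with respect to $e^{2 i\pi k\cdot}$. Besov spaces: fix non-negative $\varphi_0,\varphi_1$ in the Schwartz class $\mathcal{S}(\mathbb{R})$ with $\mathrm{Supp}\,\varphi_0 \subset \{|x|\le 2\}$, $\mathrm{Supp}\,\varphi_1\subset\{1\le |x|\le 4\}$, and $\sum_{j\ge 0}\varphi_j = 1$, where $\varphi_j = \varphi_1(2^{-(j-1)}\cdot)$ for $j\ge 2$. For $0<p,q\le\infty$ and $s\in\mathbb{R}$, $B_{p,q}^s(\mathbb{T})$ is the space of $f\in\mathcal{S}'(\mathbb{T})$ such that $$\|f\|_{B^s_{p,q}} = \Big(\sum_{j\ge 0} 2^{jsq} \Big\|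 \sum_{k\in\mathbb{Z}} \varphi_j(k)\widehat{f}_k e^{2 i\pi k\cdot}\Big\|_{L_p}^q\Big)^{1/q}<\infty$$ (with a supremum over $j$ of $2^{js}\|\cdot\|_{L_p}$ if $q=\infty$). The space does not depend on the choice of $(\varphi_j)$. Critical smoothness: $s_f(p)=\sup\{s\in\mathbb{R} : f\in B^s_{p,q}(\mathbb{T})\}\in(-\infty,\infty]$, which does not depend on $q\in(0,\infty]$. *)

(* Defs.v *)
From HB Require Import structures.
From mathcomp Require Import all_boot all_order all_algebra.
From mathcomp Require Import ring lra.
From mathcomp Require Import complex.
From mathcomp Require Import all_classical all_reals all_analysis.

Set Implicit Arguments.
Unset Strict Implicit.
Unset Printing Implicit Defensive.

Import Order.TTheory GRing.Theory Num.Theory.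
Import numFieldNormedType.Exports.

Local Open Scope classical_set_scope.
Local Open Scope complex_scope.
Local Open Scope ring_scope.

Section Besov.
Context (R : realType).
Implicit Types (a b c x : R).

Definition smooth (f : R -> R) := forall n x, derivable (derive1n n f) x 1.

Lemma derive1n_lin (f g : R -> R) a b n : smooth f -> smooth g ->
  derive1n n (fun x => a * f x + b * g x) =
  fun x => a * derive1n n f x + b * derive1n n g x.
Proof.
move=> sf sg; elim: n => [//|n IH]; rewrite derive1nS IH; apply/funext => x.
have df := sf n x; have dg := sg n x.
move: df dg; rewrite !derive1nS; set F := derive1n n f; set G := derive1n n g.
move=> df dg; rewrite (_ : (fun x => a * F x + b * G x) = a *: F + b *: G)//.
rewrite !derive1E.
have daF : derivable (a *: F) x 1 by exact: derivableZ.
have dbG : derivable (b *: G) x 1 by exact: derivableZ.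
by rewrite (deriveD daF dbG) (deriveZ a df) (deriveZ b dg).
Qed.

Lemma smooth_lin (f g : R -> R) a b : smooth f -> smooth g ->
  smooth (fun x => a * f x + b * g x).
Proof.
move=> sf sg n x; rewrite derive1n_lin//.
by apply: derivableD; apply: derivableZ.
Qed.
Arguments smooth_lin {f g} a b.

Lemma smooth_trig a b c :
  smooth (fun x => a * cos (c * x) + b * sin (c * x)).
Proof.
have dtrig (x p q : R) : is_derive x 1 (fun x => p * cos (c * x) + q * sin (c * x))
    ((c * q) * cos (c * x) + (- (c * p)) * sin (c * x)).
  have dc : is_derive x 1 (fun y : R => c * y) c.
    by apply: is_derive_eq; rewrite /GRing.scale/= mulr1.
  have dcos : is_derive x 1 (fun y : R => cos (c * y)) (- sin (c * x) * c).
    exact: (@is_derive1_comp _ cos (fun y : R => c * y)).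
  have dsin : is_derive x 1 (fun y : R => sin (c * y)) (cos (c * x) * c).
    exact: (@is_derive1_comp _ sin (fun y : R => c * y)).
  by apply: is_derive_eq; rewrite /GRing.scale/=; ring.
move=> n x.
suff [p [q ->]] : exists p q,
    derive1n n (fun x => a * cos (c * x) + b * sin (c * x)) =
    (fun x => p * cos (c * x) + q * sin (c * x)).
  by case: (dtrig x p q).
elim: n => [|n [p [q IH]]]; first by exists a, b.
exists (c * q), (- (c * p)); rewrite derive1nS IH; apply/funext => y.
by rewrite derive1E; exact: (@derive_val _ _ _ _ _ _ _ (dtrig y p q)).
Qed.
Arguments smooth_trig : clear implicits.

Definition Cderive1n n (u : R -> R[i]^o) : R -> R[i]^o := fun x =>
  derive1n n (fun y => complex.Re (u y)) x +i*
  derive1n n (fun y => complex.Im (u y)) x.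

Definition smooth_periodic : {pred (R -> R[i]^o)} := fun u =>
  `[< [/\ smooth (fun x => complex.Re (u x)),
          smooth (fun x => complex.Im (u x)) & forall x, u (x + 1) = u x] >].

Lemma smooth_periodic_submod : submod_closed smooth_periodic.
Proof.
have s0 : smooth (fun=> 0).
  have := smooth_trig 0 0 0; congr smooth; apply/funext => x.
  by rewrite !mul0r addr0.
split; first by apply/asboolP; split => //= x.
move=> a u v /asboolP[ru iu pu] /asboolP[rv iv pv].
apply/asboolP; split => [||x]; last by rewrite !fctE pu pv.
- have := smooth_lin 1 1 (smooth_lin (complex.Re a) (- complex.Im a) ru iu) rv.
  congr smooth; apply/funext => x /=; rewrite !fctE.
  by case: a (u x) (v x) => [? ?] [? ?] [? ?] /=; ring.
- have := smooth_lin 1 1 (smooth_lin (complex.Re a) (complex.Im a) iu ru) iv.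
  congr smooth; apply/funext => x /=; rewrite !fctE.
  by case: a (u x) (v x) => [? ?] [? ?] [? ?] /=; ring.
Qed.
HB.instance Definition _ :=
  GRing.isSubmodClosed.Build _ _ smooth_periodic smooth_periodic_submod.

(* The space S(T) of smooth functions on T = R/Z. *)
Record testfun : Type := Testfun {
  testfun_val :> R -> R[i]^o ;
  _ : testfun_val \in smooth_periodic }.
HB.instance Definition _ := [isSub for testfun_val].
HB.instance Definition _ := [Choice of testfun by <:].
HB.instance Definition _ := [SubChoice_isSubLmodule of testfun by <:].

(* Fréchet topology of S(T): uniform convergence of all derivatives. *)
Definition jet (u : testfun) : {ptws nat -> {uniform R -> R[i]^o}} :=
  fun n => Cderive1n n u.
HB.instance Definition _ := Uniform.copy testfun (initial_topology jet).

Definition is_periodic_distribution : {pred (testfun -> R[i]^o)} := fun f =>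
  `[< linear f /\ continuous f >].

Lemma is_periodic_distribution_submod : submod_closed is_periodic_distribution.
Proof.
split.
  apply/asboolP; split; first by move=> a u v; rewrite scaler0 addr0.
  exact: cst_continuous.
move=> a f g /asboolP[lf cf] /asboolP[lg cg]; apply/asboolP; split.
  move=> b u v; rewrite !fctE lf lg !scalerDr !scalerA [a * b]mulrC.
  by rewrite addrACA.
move=> u; apply: continuousD; last exact: cg.
by apply: continuousZl_tmp; exact: cf.
Qed.
HB.instance Definition _ :=
  GRing.isSubmodClosed.Build _ _ is_periodic_distribution is_periodic_distribution_submod.

Record periodic_distribution : Type := PeriodicDistribution {
  periodic_distribution_val :> testfun -> R[i]^o ;
  _ : periodic_distribution_val \in is_periodic_distribution }.
HB.instance Definition _ := [isSub for periodic_distribution_val].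
HB.instance Definition _ := [Choice of periodic_distribution by <:].
HB.instance Definition _ := [SubChoice_isSubLmodule of periodic_distribution by <:].

(* The character e_k(x) = exp(2 i pi k x). *)
Definition expi (k : int) : R -> R[i]^o := fun x =>
  cos (2 * pi * k%:~R * x) +i* sin (2 * pi * k%:~R * x).

Lemma expi_smooth_periodic k : expi k \in smooth_periodic.
Proof.
apply/asboolP; split => [||x].
- have := smooth_trig 1 0 (2 * pi * k%:~R); congr smooth; apply/funext => x.
  by rewrite mul1r mul0r addr0.
- have := smooth_trig 0 1 (2 * pi * k%:~R); congr smooth; apply/funext => x.
  by rewrite mul1r mul0r add0r.
- have step (y : R) (n : nat) : cos (y + (pi *+ 2) *+ n) = cos y /\
      sin (y + (pi *+ 2) *+ n) = sin y.
    by rewrite (periodicn (@cosD2pi R)) (periodicn (@sinD2pi R)).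
  rewrite /expi mulrDr mulr1; set y := _ * x.
  have -> : 2 * pi * k%:~R = (pi *+ 2) *~ k :> R.
    by rewrite -(mulr_natl pi 2) mulrzr.
  case: k @y => n y; first by have [-> ->] := step y n.
  rewrite NegzE mulrNz.
  have [<- <-] := step (y - (pi *+ 2) *~ n.+1) n.+1.
  by rewrite pmulrn subrK.
Qed.
Definition echar k : testfun := Testfun (expi_smooth_periodic k).

Definition fourier_coef (f : periodic_distribution) (k : int) : R[i] := f (echar (- k)).

Definition schwartz (phi : R -> R) := smooth phi /\
  forall m n, exists M, forall x, `|x ^+ m * derive1n n phi x| <= M.

(* For j = 1 the dilation factor is 1, so [phi_ phi0 phi1 1] is phi1 itself. *)
Definition phi_ (phi0 phi1 : R -> R) (j : nat) : R -> R :=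
  if j is i.+1 then fun x => phi1 (x / 2 ^+ i) else phi0.

Record dyadic_partition (phi0 phi1 : R -> R) : Prop := DyadicPartition {
  dyadic_schwartz0 : schwartz phi0 ;
  dyadic_schwartz1 : schwartz phi1 ;
  dyadic_ge0_0 : forall x, 0 <= phi0 x ;
  dyadic_ge0_1 : forall x, 0 <= phi1 x ;
  dyadic_supp0 : closure [set x | phi0 x != 0] `<=` [set x | `|x| <= 2] ;
  dyadic_supp1 : closure [set x | phi1 x != 0] `<=` [set x | 1 <= `|x| <= 4] ;
  dyadic_sum : forall x,
    series (fun j => phi_ phi0 phi1 j x) n @[n --> \oo] --> (1 : R) }.

(* The k-sum has finite support because phi_j is compactly supported. *)
Definition dyadic_block phi0 phi1 (f : periodic_distribution) (j : nat) (x : R) : R[i] :=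
  \sum_(k \in [set: int])
    ((phi_ phi0 phi1 j k%:~R)%:C * fourier_coef f k * expi k x).

(* Lebesgue measure on the fundamental domain [0, 1] of T. *)
Definition torus_measure : {measure set (measurableTypeR R) -> \bar R} :=
  mrestr (@lebesgue_measure R) (measurable_itv `[0, 1]).

Definition block_norm phi0 phi1 (p : \bar R) f j : \bar R :=
  Lnorm torus_measure p
    (fun x => (Normc.normc (dyadic_block phi0 phi1 f j x))%:E).

(* Only 0 < p, q <= +oo is meaningful; q = -oo gets a dummy value. *)
Definition besov_norm phi0 phi1 (s : R) (p q : \bar R) f : \bar R :=
  match q with
  | r%:E => (\sum_(0 <= j <oo)
      (2 `^ (j%:R * s * r))%:E * block_norm phi0 phi1 p f j `^ r) `^ r^-1
  | +oo => ereal_sup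
      (range (fun j => (2 `^ (j%:R * s))%:E * block_norm phi0 phi1 p f j))
  | -oo => +oo
  end%E.

Definition besov_space phi0 phi1 s p q : set periodic_distribution :=
  [set f | (besov_norm phi0 phi1 s p q f < +oo)%E].

Definition critical_smoothness phi0 phi1 q f p : \bar R :=
  ereal_sup [set s%:E | s in [set s | besov_space phi0 phi1 s p q f]].

End Besov.

(* Main.v *)
Require Import Defs.
From mathcomp Require Import all_boot all_order all_algebra.
From mathcomp Require Import zify ring lra.
From mathcomp Require Import complex.
From mathcomp Require Import all_classical all_reals all_analysis.
From mathcomp Require Import ess_sup_inf measurable_realfun.

Set Implicit Arguments.
Unset Strict Implicit.
Unset Printing Implicit Defensive.

Import Order.TTheory GRing.Theory Num.Theory.
Import numFieldNormedType.Exports.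
Import ComplexField.Normc.

Local Open Scope classical_set_scope.
Local Open Scope complex_scope.
Local Open Scope ring_scope.

(** The first two assertions only use that [B^s_{p,q}] is a vector space which
    shrinks as [s] grows. The block norms are quasi-norms
    ([block_normZ_le], [block_normD_le]), so [f + g] belongs to [B^s] as soon
    as [f] and [g] do; hence [s_(f+g) >= min (s_f, s_g)] at every [p]
    ([critical_add_ge]). If say [s_f < s_g], applying this to
    [f = (f + g) - g] gives the converse inequality ([critical_add_neq]).

    For the third assertion one compares two exponents [r < p]. The function
    [s_f] satisfies
    [s_f(p) <= s_f(r) <= s_f(p) + 2 (1/r - 1/p)], with [1/oo = 0]
    ([critical_anti], [critical_sobolev]). Because the exceptional set is
    countable, there are [r < p] outside it with [1/r - 1/p] as small as
    desired ([cocountable_exponent]), and at such an [r] the second assertion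
    applies:
    [s_(f+g)(p) <= s_(f+g)(r) = min (s_f(r), s_g(r))
                <= min (s_f(p), s_g(p)) + 2 (1/r - 1/p)].
    Letting [r] tend to [p] concludes. Only the continuity of [s_f] in [1/p]
    matters here, not the sharp constant [1] of the Sobolev embedding, so a
    lossy form of the Nikolskii inequality is enough and it can be proved by
    elementary means for all exponents at once, including [p < 1] and
    [p = oo].

    That inequality rests on the following observation. The [j]-th block is a
    trigonometric polynomial [T] with [O(2^j)] frequencies of size [O(2^j)].
    Discrete orthogonality at the points [m/n] bounds each coefficient by
    [A = sup |T|] ([trigpoly_coef_le]), so [|T|] is Lipschitz with constant
    [L A], where [L = O(4^j)] ([block_modulus_peak]). Around a point where
    [|T| = A] there is thus an interval of length [1 / (2 L)] on which
    [|T| >= A / 2], which yields [A <= 2 (2 L)^(1/p) |T|_p]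
    ([peak_le_Lnorm]). Interpolating between [L^p] and [sup], one gets
    [|T|_P <= C L^(1/p - 1/P) |T|_p] for [p < P] ([peak_Lnorm_reverse]). *)

(** * Trigonometric polynomials *)

Section Characters.
Context {R : realType}.
Implicit Types (x y : R) (k l : int).

Lemma expiD k x y : expi k (x + y) = expi k x * expi k y :> R[i].
Proof.
rewrite /expi mulrDr cosD sinD.
by apply/eqP; rewrite eq_complex /=; apply/andP; split; apply/eqP; ring.
Qed.

Lemma expi_addl k l x : expi (k + l) x = expi k x * expi l x :> R[i].
Proof.
rewrite /expi intrD mulrDr mulrDl cosD sinD.
by apply/eqP; rewrite eq_complex /=; apply/andP; split; apply/eqP; ring.
Qed.

Lemma expi_index0 x : expi 0 x = 1 :> R[i].
Proof. by rewrite /expi mulr0 mul0r cos0 sin0. Qed.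

Lemma expi0 k : expi k 0 = 1 :> R[i].
Proof. by rewrite /expi mulr0 cos0 sin0. Qed.

Lemma expi1 k : expi k 1 = 1 :> R[i].
Proof.
have /asboolP[_ _ per] := @expi_smooth_periodic R k.
by rewrite -[1 in LHS]add0r per expi0.
Qed.

Lemma expiMn k x n : expi k (x *+ n) = expi k x ^+ n :> R[i].
Proof.
elim: n => [|n IH]; first by rewrite mulr0n expi0 expr0.
by rewrite mulrS expiD IH exprS.
Qed.

Lemma normc_expi k x : normc (expi k x : R[i]) = 1.
Proof. by rewrite /expi /= cos2Dsin2 sqrtr1. Qed.

Lemma cos_neq1 x : 0 < `|x| < 2 * pi -> cos x != 1.
Proof.
have cos_half y : cos y = 1 - sin (y / 2) ^+ 2 *+ 2.
  have {1}-> : y = (y / 2) *+ 2 by rewrite -[in RHS]mulr_natr; field.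
  rewrite cos_mulr2n -[X in _ *+ 2 - X](cos2Dsin2 (y / 2)).
  by rewrite -[X in X - _ *+ 2](cos2Dsin2 (y / 2)); ring.
have -> : cos x = cos `|x| by case: (ler0P x) => // _; rewrite cosN.
move=> /andP[x0 x2]; rewrite cos_half.
have s0 : 0 < sin (`|x| / 2) by apply: sin_gt0_pi; lra.
by rewrite lt_eqF// ltrBlDr ltrDl pmulrn_lgt0// exprn_gt0.
Qed.

(** The sum is geometric, with ratio an [n]-th root of unity that differs
    from [1] because [0 < |k| < n]. *)
Lemma expi_sum_eq0 n k : k != 0 -> (`|k| < n)%N ->
  \sum_(m < n) expi k (m%:R / n%:R) = 0 :> R[i].
Proof.
move=> k0 kn.
have n0 : (0 < n)%N by apply: leq_ltn_trans kn.
have nR : (n%:R : R) != 0 by rewrite pnatr_eq0 -lt0n.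
pose z : R[i] := expi k (n%:R^-1).
have z1 : z - 1 != 0.
  rewrite subr_eq0 /z /expi eq_complex /= negb_and cos_neq1//.
  rewrite !normrM normfV normr_nat (ger0_norm (pi_ge0 R)).
  rewrite (ger0_norm (_ : 0 <= n%:R :> R))// -intr_norm -abszE.
  have k1 : (0 < `|k|)%N by rewrite absz_gt0.
  rewrite -mulrA; apply/andP; split.
    rewrite !mulr_gt0 ?pi_gt0// ?invr_gt0 ?ltr0n//.
  rewrite gtr_pMr ?mulr_gt0 ?pi_gt0// ltr_pdivrMr ?ltr0n// mul1r.
  by rewrite ltr_nat.
have zn : z ^+ n = 1 by rewrite /z -expiMn -(mulr_natr n%:R^-1) mulVf// expi1.
apply: (mulfI z1); rewrite mulr0 (eq_bigr (fun m : 'I_n => z ^+ m)).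
  by rewrite -subrX1 zn subrr.
by move=> m _; rewrite -expiMn -(mulr_natr n%:R^-1) mulrC.
Qed.

Lemma dist_le_of_derive_le1 (F : R -> R) (dF : R -> R) x y :
  (forall z, is_derive z (1 : R) F (dF z)) -> (forall z, `|dF z| <= 1) ->
  `|F x - F y| <= `|x - y|.
Proof.
move=> dFE dF1; wlog xy : x y / y <= x.
  by move=> H; have [/H//|/ltW/H] := leP y x; rewrite distrC (distrC x).
have [|z _ ->] := MVT_segment xy (fun z _ => dFE z).
  apply: derivable_within_continuous => z _; by case: (dFE z).
by rewrite normrM ler_piMl.
Qed.

Lemma normc_le_ReIm (z : R[i]) : normc z <= `|complex.Re z| + `|complex.Im z|.
Proof.
case: z => a b /=.
rewrite -[leRHS]ger0_norm ?addr_ge0// -sqrtr_sqr ler_sqrt ?sqr_ge0//.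
by rewrite sqrrD !real_normK ?num_real// -addrA lerD2l lerDr mulrn_wge0 ?mulr_ge0.
Qed.

Lemma expi_lipschitz k x y :
  normc (expi k x - expi k y : R[i]) <= 4 * pi * `|k|%:R * `|x - y|.
Proof.
apply: le_trans (normc_le_ReIm _) _; rewrite /expi /=.
have E : `|2 * pi * k%:~R * x - 2 * pi * k%:~R * y| = 2 * pi * `|k|%:R * `|x - y|.
  rewrite -mulrBr !normrM normr_nat (ger0_norm (pi_ge0 R)).
  by rewrite -intr_norm -abszE.
have -> : 4 * pi * `|k|%:R * `|x - y| =
    2 * pi * `|k|%:R * `|x - y| + 2 * pi * `|k|%:R * `|x - y| by ring.
rewrite -E; apply: lerD.
  apply: (@dist_le_of_derive_le1 _ (fun z => - sin z)) => z.
  by rewrite normrN ler_norml sin_geN1 sin_le1.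
apply: (@dist_le_of_derive_le1 _ cos) => z.
by rewrite ler_norml cos_geN1 cos_le1.
Qed.

End Characters.

Section TrigPoly.
Context {R : realType}.

(** Frequencies run from [- N] to [n - 1 - N], that is over [-N, N] when
    [n = 2 N + 1]. *)
Definition trigpoly n (N : nat) (c : 'I_n -> R[i]) (x : R) : R[i] :=
  \sum_(i < n) c i * expi (i%:Z - N%:Z) x.

(** Discrete Fourier inversion: two frequencies of the polynomial differ by
    less than [n], so their characters are orthogonal on the [n] equispaced
    points [m/n]. *)
Lemma trigpoly_coefE n N (c : 'I_n -> R[i]) i : c i *+ n =
  \sum_(m < n) trigpoly N c (m%:R / n%:R) * expi (N%:Z - i%:Z) (m%:R / n%:R).
Proof.
under eq_bigr do rewrite /trigpoly mulr_suml.
rewrite exchange_big /= (bigD1 i)//= [X in _ + X]big1 ?addr0.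
  rewrite -{1}[n]card_ord -sumr_const; apply: eq_bigr => m _.
  by rewrite -mulrA -expi_addl -(opprB (i%:Z)) addrN expi_index0 mulr1.
move=> l li; under eq_bigr do rewrite -mulrA -expi_addl.
rewrite -mulr_sumr expi_sum_eq0 ?mulr0//.
  by rewrite addrA subrK subr_eq0.
rewrite addrA subrK; have := ltn_ord i; have := ltn_ord l.
by move: (nat_of_ord i) (nat_of_ord l) => a b; lia.
Qed.

Lemma normc_sum n (F : 'I_n -> R[i]) :
  normc (\sum_i F i) <= \sum_i normc (F i).
Proof.
elim/big_ind2 : _ => [|a b c d ab cd|//]; first by rewrite normc0.
by apply: le_trans (le_normcD _ _) _; exact: lerD.
Qed.

Lemma ler_sum_const n (F : 'I_n -> R) B :
  (forall i, F i <= B) -> \sum_i F i <= n%:R * B.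
Proof.
move=> FB; apply: (@le_trans _ _ (\sum_(i < n) B)); first exact: ler_sum.
by rewrite sumr_const card_ord mulr_natl.
Qed.

Lemma trigpoly_coef_le n N (c : 'I_n -> R[i]) (A : R) :
  (forall x, 0 <= x <= 1 -> normc (trigpoly N c x) <= A) ->
  forall i, normc (c i) <= A.
Proof.
move=> TA i; have n0 : (0 < n)%N by apply: leq_ltn_trans (ltn_ord i).
rewrite -(@ler_pM2r _ n%:R) ?ltr0n// !mulr_natr -normcMn (trigpoly_coefE N).
apply: le_trans (normc_sum _) _.
rewrite -(mulr_natl A); apply: ler_sum_const => m.
rewrite normcM normc_expi mulr1 TA// divr_ge0//= ler_pdivrMr ?ltr0n// mul1r.
by rewrite ler_nat ltnW.
Qed.

Lemma ler_dist_normc (z w : R[i]) : `|normc z - normc w| <= normc (z - w).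
Proof.
rewrite ler_norml lerBlDl lerBrDr.
rewrite -[normc z in X in _ && X](_ : normc (w + (z - w)) = _); last first.
  by rewrite addrC subrK.
rewrite le_normcD andbT.
rewrite addrC lerBlDr -(normcN (z - w)) opprB -{1}(subrK z w).
by rewrite addrC le_normcD.
Qed.

(** A crude Bernstein inequality: it loses a factor [N] with respect to the
    sharp one, since it sums the bounds on all the terms. *)
Lemma trigpoly_lipschitz n N (c : 'I_n -> R[i]) (A : R) : (n <= N.*2.+1)%N ->
  (forall x, 0 <= x <= 1 -> normc (trigpoly N c x) <= A) ->
  forall x y, `|normc (trigpoly N c x) - normc (trigpoly N c y)| <=
    (n%:R * (4 * pi * N%:R)) * A * `|x - y|.
Proof.
move=> nN TA x y; apply: le_trans (ler_dist_normc _ _) _.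
rewrite /trigpoly -sumrB; apply: le_trans (normc_sum _) _.
rewrite -!mulrA; apply: ler_sum_const => i; rewrite -mulrBr normcM.
have c0 : 0 <= normc (c i) by case: (c i) => a b; exact: sqrtr_ge0.
have cA := trigpoly_coef_le TA i.
apply: le_trans (ler_pM c0 _ cA (expi_lipschitz _ _ _)) _.
  by case: (_ - _) => a b; exact: sqrtr_ge0.
have kN : `|i%:Z - N%:Z|%:R <= N%:R :> R.
  by rewrite ler_nat; have := ltn_ord i; move: (nat_of_ord i) => a; lia.
have W0 : 0 <= A * 4 * pi * `|x - y|.
  by rewrite !mulr_ge0 ?pi_ge0// (le_trans c0).
have := ler_wpM2l W0 kN; congr (_ <= _); ring.
Qed.

End TrigPoly.

(** * Lebesgue norms for all positive exponents *)

Section Powers.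
Context {R : realType}.
Local Open Scope ereal_scope.

Lemma lee_poweR2r (a b : \bar R) (r : R) : (0 < r)%R -> 0 <= a -> 0 <= b ->
  a `^ r <= b `^ r -> a <= b.
Proof.
move=> r0 a0 b0 ab.
have := gt0_ler_poweR (_ : 0 <= r^-1)%R _ _ ab.
rewrite -!poweRrM mulfV ?gt_eqF// !poweRe1//; apply.
- by rewrite invr_ge0 ltW.
- by rewrite in_itv/= leey poweR_ge0.
- by rewrite in_itv/= leey poweR_ge0.
Qed.

(** Valid also for exponents [r < 1], where [powR] is not convex: [a + b] is
    at most twice the larger of the two terms. *)
Lemma ler_powR_sum (a b c k r : R) : (0 <= c)%R -> (0 <= a)%R -> (0 <= b)%R ->
  (0 <= k)%R -> (0 <= r)%R -> (c <= k * (a + b) ->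
  c `^ r <= (k * 2) `^ r * (a `^ r + b `^ r))%R.
Proof.
move=> c0; wlog ab : a b / (b <= a)%R.
  move=> H a0 b0 k0 r0 cab; have [/H|/ltW/H] := leP b a; first exact.
  by rewrite (addrC b) (addrC (b `^ r)%R); apply.
move=> a0 b0 k0 r0 cab.
have cka : (c <= k * 2 * a)%R.
  by apply: le_trans cab _; rewrite -mulrA ler_wpM2l// mulrDl mul1r lerD2l.
have := ge0_ler_powR r0 _ _ cka; rewrite !nnegrE => /(_ c0).
rewrite !mulr_ge0// => /(_ isT)/le_trans; apply.
by rewrite powRM ?mulr_ge0// ler_wpM2l ?powR_ge0// lerDl powR_ge0.
Qed.

End Powers.

Section LebesgueNorms.
Context d (T : measurableType d) (R : realType).
Variable mu : {measure set T -> \bar R}.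
Implicit Types (u v w : T -> R) (p r A : R) (P : \bar R).
Local Open Scope ereal_scope.

Local Notation N P u := (Lnorm mu P (fun x => (u x)%:E)).

Lemma measurable_powR_fun u r : measurable_fun setT u ->
  measurable_fun setT (fun x => (u x `^ r)%:E : \bar R).
Proof.
move=> mu_; apply/measurable_EFinP.
exact: (measurableT_comp (measurable_powR r) mu_).
Qed.

Lemma Lnorm_ge0E u r : (forall x, 0 <= u x)%R ->
  N r%:E u = (\int[mu]_x (u x `^ r)%:E) `^ r^-1.
Proof.
move=> u0; rewrite unlock; congr (_ `^ _); apply: eq_integral => x _.
by rewrite /= ger0_norm// poweR_EFin.
Qed.

Lemma powR_Lnorm_ge0 u r : (0 < r)%R -> (forall x, 0 <= u x)%R ->
  N r%:E u `^ r = \int[mu]_x (u x `^ r)%:E.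
Proof.
move=> r0 u0; rewrite Lnorm_ge0E// -poweRrM mulVf ?gt_eqF// poweRe1//.
by apply: integral_ge0 => x _; rewrite lee_fin powR_ge0.
Qed.

(** A single substitute, up to a constant, for the Minkowski inequality, which
    fails for [P < 1], and, with [v = u], for homogeneity. *)
Lemma Lnorm_quasi_triangle P (k : R) : 0 < P -> (0 <= k)%R ->
  exists2 C : R, (0 <= C)%R & forall u v w, measurable_fun setT u -> measurable_fun setT v ->
    measurable_fun setT w -> (forall x, 0 <= u x)%R -> (forall x, 0 <= v x)%R ->
    (forall x, 0 <= w x)%R ->
    (forall x, w x <= k * (u x + v x))%R ->
    N P w <= C%:E * maxe (N P u) (N P v).
Proof.
case: P => [r| |//]; last first.
  move=> _ k0; exists (k * 2)%R => [|u v w mfu mfv mfw u0 v0 w0 wuv].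
    exact: mulr_ge0.
  set M := maxe _ _.
  rewrite {1}unlock; case: ifPn => [muT|_]; last first.
    by rewrite mule_ge0 ?lee_fin ?mulr_ge0// /M le_max Lnorm_ge0.
  apply/ess_supP.
  have Mu : {ae mu, forall x, (u x)%:E <= M}.
    have := ess_sup_ge mu (abse \o (fun x => (u x)%:E)).
    apply: filterS => x /=; rewrite ger0_norm// => /le_trans; apply.
    by rewrite /M le_max unlock muT lexx.
  have Mv : {ae mu, forall x, (v x)%:E <= M}.
    have := ess_sup_ge mu (abse \o (fun x => (v x)%:E)).
    apply: filterS => x /=; rewrite ger0_norm// => /le_trans; apply.
    by rewrite /M le_max unlock muT lexx orbT.
  apply: filterS2 Mu Mv => x Mu Mv /=; rewrite ger0_norm//.
  apply: (@le_trans _ _ (k%:E * (M + M))).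
    apply: (@le_trans _ _ (k%:E * ((u x)%:E + (v x)%:E))).
      by rewrite -EFinD -EFinM lee_fin.
    by rewrite lee_wpmul2l ?lee_fin// leeD.
  by rewrite EFinM -muleA mule_natl mule2n.
rewrite lte_fin => r0 k0.
(* chosen so that C ^ r = (k * 2) ^ r * 2 *)
exists (((k * 2) `^ r * 2) `^ r^-1)%R => [|u v w mfu mfv mfw u0 v0 w0 wuv].
  exact: powR_ge0.
set M := maxe _ _.
have M0 : 0 <= M by rewrite /M le_max Lnorm_ge0.
apply: (lee_poweR2r r0); rewrite ?Lnorm_ge0 ?mule_ge0 ?lee_fin ?powR_ge0//.
rewrite poweRM ?lee_fin ?powR_ge0// poweR_EFin -powRrM mulVf ?gt_eqF//.
rewrite powRr1 ?mulr_ge0 ?powR_ge0//.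
rewrite powR_Lnorm_ge0//.
apply: (@le_trans _ _ (\int[mu]_x (((k * 2) `^ r)%:E *
    ((u x `^ r)%:E + (v x `^ r)%:E)))).
  apply: ge0_le_integral => //.
  - by move=> x _; rewrite lee_fin powR_ge0.
  - exact: measurable_powR_fun.
  - apply: measurable_funeM; apply: emeasurable_funD; exact: measurable_powR_fun.
  - move=> x _; rewrite -EFinD -EFinM lee_fin.
    by apply: ler_powR_sum => //; rewrite ltW.
rewrite ge0_integralZl//; last 3 first.
- by apply: emeasurable_funD; exact: measurable_powR_fun.
- by move=> x _; rewrite -EFinD lee_fin addr_ge0 ?powR_ge0.
- by rewrite lee_fin powR_ge0.
rewrite ge0_integralD//; last 4 first.
- by move=> x _; rewrite lee_fin powR_ge0.
- exact: measurable_powR_fun.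
- by move=> x _; rewrite lee_fin powR_ge0.
- exact: measurable_powR_fun.
rewrite EFinM -muleA lee_wpmul2l ?lee_fin ?powR_ge0//.
rewrite -!powR_Lnorm_ge0// mule_natl mule2n.
by apply: leeD; apply: gt0_ler_poweR;
  rewrite ?in_itv/= ?leey ?Lnorm_ge0 ?M0 ?(ltW r0)// /M le_max lexx ?orbT.
Qed.

Hypothesis mu1 : mu setT = 1.

Lemma Lnorm_le_const P u A : 0 < P -> measurable_fun setT u -> (0 <= A)%R ->
  (forall x, 0 <= u x)%R -> {ae mu, forall x, u x <= A}%R -> N P u <= A%:E.
Proof.
case: P => [r| |//]; last first.
  move=> _ mfu A0 u0 uA; rewrite unlock mu1 lte01; apply/ess_supP.
  by apply: filterS uA => x /=; rewrite ger0_norm.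
rewrite lte_fin => r0 mfu A0 u0 uA.
apply: (lee_poweR2r r0); rewrite ?Lnorm_ge0 ?lee_fin//.
rewrite powR_Lnorm_ge0//.
have <- : \int[mu]_x (cst (A `^ r)%:E) x = A%:E `^ r.
  by rewrite integral_cst// mu1 mule1 poweR_EFin.
apply: ae_ge0_le_integral => //.
- by move=> x _; rewrite lee_fin powR_ge0.
- exact: measurable_powR_fun.
- by move=> x _; rewrite lee_fin powR_ge0.
apply: filterS uA => x uA _; rewrite lee_fin ge0_ler_powR ?nnegrE//.
exact: ltW.
Qed.

(** For [P = r] finite, Hoelder's inequality applied to [u ^ p] and the
    constant [1], with the conjugate exponents [r / p] and
    [(1 - p / r)^-1]. *)
Lemma Lnorm_le_exponent p P u : (0 < p)%R -> p%:E < P -> measurable_fun setT u ->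
  (forall x, 0 <= u x)%R -> N p%:E u <= N P u.
Proof.
move=> p0; case: P => [r| |//]; last first.
  move=> _ mfu u0; have [->|] := eqVneq (N +oo u) +oo; first by rewrite leey.
  rewrite -ltey => fin.
  have finN : N +oo u \is a fin_num by rewrite ge0_fin_numE ?Lnorm_ge0.
  rewrite -(fineK finN); apply: Lnorm_le_const => //.
    by rewrite fine_ge0 ?Lnorm_ge0.
  have := ess_sup_ge mu (abse \o (fun x => (u x)%:E)).
  apply: filterS => x /=; rewrite ger0_norm// -lee_fin fineK//.
  by rewrite unlock mu1 lte01.
rewrite lte_fin => pr mfu u0.
have r0 : (0 < r)%R := lt_trans p0 pr.
apply: (lee_poweR2r p0); rewrite ?Lnorm_ge0//.
rewrite powR_Lnorm_ge0//.
have mfp : measurable_fun setT (fun x => u x `^ p)%R.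
  by apply/measurable_EFinP; exact: measurable_powR_fun.
have rp0 : (0 < r / p)%R by rewrite divr_gt0.
have conj0 : (0 < 1 - p / r)%R by rewrite subr_gt0 ltr_pdivrMr// mul1r.
have := @hoelder _ T R mu (fun x => u x `^ p)%R (cst 1%R)
  (r / p)%R ((1 - p / r)^-1)%R mfp.
move=> /(_ (@measurable_cst _ _ _ _ _ _)).
rewrite invr_gt0 rp0 conj0 invrK invf_div subrKC => /(_ isT isT erefl).
rewrite Lnorm1.
under eq_integral do rewrite /= mulr1 ger0_norm ?powR_ge0//.
move=> /le_trans; apply.
rewrite [X in _ * X](_ : _ = 1) ?mule1; last first.
  by have := Lnorm_cst1 mu ((1 - p / r)^-1)%R; rewrite mu1 poweR1r.
rewrite !Lnorm_ge0E//; last by move=> x; exact: powR_ge0.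
rewrite -poweRrM; under eq_integral do rewrite -powRrM.
by rewrite invf_div mulrCA mulfV ?gt_eqF// mulr1 (mulrC r^-1%R).
Qed.

(** For [P = r] finite, [u ^ r <= A ^ (r - p) * u ^ p] almost everywhere. The
    quantity [fine P^-1] is [1 / P], with value [0] at [P = +oo], so that the
    formula then reads [N +oo u <= A]. *)
Lemma Lnorm_interpolation p P u A : (0 < p)%R -> p%:E < P -> (0 <= A)%R ->
  measurable_fun setT u -> (forall x, 0 <= u x)%R ->
  {ae mu, forall x, u x <= A}%R ->
  N P u <= (A `^ (1 - p * fine P^-1))%:E * N p%:E u `^ (p * fine P^-1).
Proof.
move=> p0; case: P => [r| |//]; last first.
  move=> _ A0 mfu u0 uA; rewrite invey /= mulr0 subr0 poweRe0 mule1 powRr1//.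
  exact: Lnorm_le_const.
rewrite lte_fin => pr A0 mfu u0 uA.
have r0 : (0 < r)%R := lt_trans p0 pr.
rewrite inver gt_eqF//=.
apply: (lee_poweR2r r0); rewrite ?Lnorm_ge0 ?mule_ge0 ?lee_fin ?powR_ge0 ?poweR_ge0//.
rewrite poweRM ?lee_fin ?powR_ge0 ?poweR_ge0// -poweRrM poweR_EFin -powRrM.
rewrite mulrBl mul1r divfK ?gt_eqF// !powR_Lnorm_ge0//.
rewrite -ge0_integralZl//; last 3 first.
- exact: measurable_powR_fun.
- by move=> x _; rewrite lee_fin powR_ge0.
- by rewrite lee_fin powR_ge0.
apply: ae_ge0_le_integral => //.
- by move=> x _; rewrite lee_fin powR_ge0.
- exact: measurable_powR_fun.
- by move=> x _; rewrite -EFinM lee_fin mulr_ge0 ?powR_ge0.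
- apply: measurable_funeM; exact: measurable_powR_fun.
apply: filterS uA => x uA _; rewrite -EFinM lee_fin.
(* powers at 0 do not split as powers of sums *)
have [u00|un0] := eqVneq (u x) 0%R.
  by rewrite u00 powR0 ?gt_eqF// mulr_ge0 ?powR_ge0.
have -> : r = (r - p + p)%R by rewrite subrK.
rewrite powRD; last by rewrite un0 implybT.
rewrite addrK ler_wpM2r ?powR_ge0// ge0_ler_powR ?nnegrE//.
by rewrite subr_ge0 ltW.
Qed.

(** Inserting [A <= B * N p u] in the interpolation inequality makes the
    powers of the norm add up to [1]. *)
Lemma Lnorm_reverse p P u A (B : R) : (0 < p)%R -> p%:E < P -> (0 <= A)%R ->
  measurable_fun setT u -> (forall x, 0 <= u x)%R ->
  {ae mu, forall x, u x <= A}%R -> (0 <= B)%R -> A%:E <= B%:E * N p%:E u ->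
  N P u <= (B `^ (1 - p * fine P^-1))%:E * N p%:E u.
Proof.
move=> p0 pP A0 mfu u0 uA B0 AB.
have fin : N p%:E u \is a fin_num.
  by rewrite ge0_fin_numE ?Lnorm_ge0//; apply: le_lt_trans (ltry A); exact: Lnorm_le_const.
apply: le_trans (Lnorm_interpolation p0 pP A0 mfu u0 uA) _.
move: fin (Lnorm_ge0 mu p%:E (fun x => (u x)%:E)) AB.
case: (Lnorm _ _ _) => // n _; rewrite lee_fin poweR_EFin -!EFinM !lee_fin => n0 AB.
set t := (p * _)%R; have t1 : (0 < 1 - t)%R.
  rewrite subr_gt0 /t; case: P pP @t => [r||]//= pr; last by rewrite mulr0.
  move: pr; rewrite lte_fin => pr; have r0 := lt_trans p0 pr.
  by rewrite inver gt_eqF//= ltr_pdivrMr// mul1r.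
have [nz|nn0] := eqVneq n 0%R.
  move: AB; rewrite nz mulr0 => A_0.
  have -> : A = 0%R by apply/le_anti; rewrite A_0 A0.
  by rewrite powR0 ?gt_eqF// mul0r mulr0.
apply: (@le_trans _ _ ((B * n) `^ (1 - t) * n `^ t)%R).
  rewrite ler_wpM2r ?powR_ge0// ge0_ler_powR ?nnegrE ?mulr_ge0//; exact: ltW.
rewrite powRM// -mulrA -powRD; last by rewrite nn0 implybT.
by rewrite subrK powRr1.
Qed.

End LebesgueNorms.

(** * Lipschitz functions with a peak on the torus *)

Section Torus.
Context {R : realType}.
Implicit Types (u : R -> R) (L A : R).

Local Notation mu := (torus_measure R).
Local Notation N P u := (Lnorm mu P (fun x => (u x)%:E)).

Lemma torus_measureE (S : set (measurableTypeR R)) :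
  mu S = lebesgue_measure (S `&` `[0, 1]%classic).
Proof. by []. Qed.

Lemma torus_measure_itv (a b : R) : 0 <= a -> a <= b -> b <= 1 ->
  mu `[a, b]%classic = (b - a)%:E.
Proof.
move=> a0 ab b1.
rewrite torus_measureE (_ : _ `&` _ = `[a, b]%classic); last first.
  apply/setIidPl => x /=; rewrite !in_itv/= => /andP[ax xb].
  by rewrite (le_trans a0 ax) (le_trans xb b1).
rewrite lebesgue_measure_itv/= lte_fin lt_neqAle ab andbT.
by case: eqVneq => [->|_] /=; rewrite ?subrr -?EFinB.
Qed.

Lemma torus_measureT : mu setT = 1%E.
Proof.
rewrite torus_measureE setTI lebesgue_measure_itv/= lte_fin ltr01.
by rewrite -EFinB subr0.
Qed.

Lemma torus_ae (Q : R -> Prop) : (forall x, 0 <= x <= 1 -> Q x) ->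
  {ae mu, forall x, Q x}.
Proof.
move=> QP; exists (~` `[0, 1]%classic); split.
- by apply: measurableC; exact: measurable_itv.
- by rewrite torus_measureE setICl measure0.
- by move=> x /= Qx; apply: contra_not Qx; rewrite in_itv; exact: QP.
Qed.

(** The shape shared by the moduli of the dyadic blocks: [A] is the maximum
    over the torus, and the Lipschitz constant is proportional to it, so that
    [u] stays comparable to [A] on a set whose measure depends on [L] alone. *)
Record lipschitz_peak L A u : Prop := LipschitzPeak {
  peak_ge0 : forall x, 0 <= u x ;
  peak_le : forall x, 0 <= x <= 1 -> u x <= A ;
  peak_attained : exists2 x, 0 <= x <= 1 & u x = A ;
  peak_lipschitz : forall x y, `|u x - u y| <= L * A * `|x - y| }.

Lemma lipschitz_continuous u L : (forall x y, `|u x - u y| <= L * `|x - y|) ->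
  continuous u.
Proof.
move=> lip x; apply/cvgrPdist_le => e e0; near=> y.
apply: le_trans (lip x y) _.
have L1 : 0 < `|L| + 1 by rewrite ltr_pwDr.
have xy : `|x - y| <= e / (`|L| + 1).
  near: y; apply: cvgr_dist_le => //; exact: divr_gt0.
apply: (@le_trans _ _ ((`|L| + 1) * `|x - y|)).
  by rewrite ler_wpM2r// (le_trans (ler_norm L))// lerDl.
by rewrite mulrC -ler_pdivlMr.
Unshelve. all: by end_near. Qed.

Lemma measurable_lipschitz u L : (forall x y, `|u x - u y| <= L * `|x - y|) ->
  measurable_fun setT (u : measurableTypeR R -> measurableTypeR R).
Proof. by move=> /lipschitz_continuous; exact: continuous_measurable_fun. Qed.

(** The interval starts or ends at the maximum point, depending on the half
    of [0, 1] where this point lies; [1 <= L] makes it fit. *)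
Lemma peak_itv L A u : 1 <= L -> lipschitz_peak L A u ->
  exists a : R, [/\ 0 <= a, a + (2 * L)^-1 <= 1 &
    forall x, a <= x <= a + (2 * L)^-1 -> A / 2 <= u x].
Proof.
move=> L1 [u0 uA [z /andP[z0 z1] uz] lip].
have L0 : 0 < L by apply: lt_le_trans L1.
have d0 : 0 < (2 * L)^-1 by rewrite invr_gt0 mulr_gt0.
have d1 : (2 * L)^-1 <= 2^-1.
  by rewrite lef_pV2 ?posrE ?mulr_gt0// ler_peMr.
have A0 : 0 <= A by rewrite -uz.
have near x : `|z - x| <= (2 * L)^-1 -> A / 2 <= u x.
  move=> zx; have := lip z x; rewrite uz => /(le_trans (ler_norm _)) H.
  have : L * A * `|z - x| <= L * A * (2 * L)^-1 by rewrite ler_wpM2l// mulr_ge0// ltW.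
  have -> : L * A * (2 * L)^-1 = A / 2 by field; rewrite gt_eqF.
  by lra.
have [zh|zh] := leP z (2^-1).
  exists z; split => //; first by lra.
  by move=> x /andP[zx xz]; apply: near; rewrite ler_norml; apply/andP; split; lra.
exists (z - (2 * L)^-1); rewrite subrK; split => //; first by lra.
by move=> x /andP[zx xz]; apply: near; rewrite ler_norml; apply/andP; split; lra.
Qed.

(** Integrate [u ^ p >= (A / 2) ^ p] over an interval of length
    [(2 * L)^-1]. *)
Lemma peak_le_Lnorm L A u p : 1 <= L -> lipschitz_peak L A u -> 0 < p ->
  (A%:E <= (2 * (2 * L) `^ p^-1)%:E * N p%:E u)%E.
Proof.
move=> L1 uP p0; have [a [a0 a1 ha]] := peak_itv L1 uP.
have [u0 uA [z z01 uz] lip] := uP.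
have L0 : 0 < L by apply: lt_le_trans L1.
have d0 : 0 < (2 * L)^-1 by rewrite invr_gt0 mulr_gt0.
have A0 : 0 <= A by rewrite -uz.
have mfu := measurable_lipschitz lip.
apply: (lee_poweR2r p0); rewrite ?mule_ge0 ?Lnorm_ge0 ?lee_fin ?mulr_ge0 ?powR_ge0//.
rewrite poweRM ?lee_fin ?mulr_ge0 ?powR_ge0 ?Lnorm_ge0// !poweR_EFin.
rewrite powRM ?powR_ge0// -powRrM mulVf ?gt_eqF// powRr1 ?mulr_ge0 ?(ltW L0)//.
rewrite powR_Lnorm_ge0//.
set I := `[a, a + (2 * L)^-1]%classic.
have mI : measurable (I : set (measurableTypeR R)) by exact: measurable_itv.
have : (\int[mu]_(x in I) (cst ((A / 2) `^ p)%:E) x <= \int[mu]_x (u x `^ p)%:E)%E.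
  apply: (@le_trans _ _ (\int[mu]_(x in I) (u x `^ p)%:E)%E).
    apply: ge0_le_integral => //.
    - by move=> x _; rewrite lee_fin powR_ge0.
    - by apply: measurable_funTS; exact: measurable_powR_fun.
    - move=> x; rewrite /I /= in_itv/= => /ha H; rewrite lee_fin ge0_ler_powR ?nnegrE ?divr_ge0//.
      exact: ltW.
  apply: ge0_subset_integral => //; first exact: measurable_powR_fun.
  by move=> x _; rewrite lee_fin powR_ge0.
rewrite integral_cst// torus_measure_itv//; last by rewrite lerDl ltW.
rewrite addrAC subrr add0r => /(lee_wpmul2l (x := (2 `^ p * (2 * L))%:E)).
rewrite lee_fin mulr_ge0 ?powR_ge0 ?mulr_ge0 ?(ltW L0)// => /(_ isT); apply: le_trans.
rewrite -!EFinM lee_fin powRM ?invr_ge0//.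
have -> : 2 `^ p * (2 * L) * (A `^ p * 2^-1 `^ p / (2 * L)) =
  A `^ p * (2 `^ p * 2^-1 `^ p).
  by field; rewrite gt_eqF.
by rewrite -powRM// mulfV// powR1 mulr1.
Qed.

(** Nikolskii inequality. The constant is independent of [L], which is the
    only quantity that will depend on the dyadic scale. *)
Lemma peak_Lnorm_reverse p (P : \bar R) : 0 < p -> (p%:E < P)%E ->
  exists2 C : R, 0 <= C & forall L A u, 1 <= L -> lipschitz_peak L A u ->
    (N P u <= (C * L `^ (p^-1 - fine P^-1))%:E * N p%:E u)%E.
Proof.
move=> p0 pP; set t := fine _.
exists ((2 * 2 `^ p^-1) `^ (1 - p * t)); first exact: powR_ge0.
move=> L A u L1 uP; have [u0 uA [z z01 uz] lip] := uP.
have L0 : 0 < L by apply: lt_le_trans L1.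
have A0 : 0 <= A by rewrite -uz.
have := Lnorm_reverse torus_measureT p0 pP A0 (measurable_lipschitz lip) u0
   (torus_ae uA) _ (peak_le_Lnorm L1 uP p0).
rewrite mulr_ge0 ?powR_ge0// => /(_ isT)/le_trans; apply.
rewrite -/t (@powRM _ 2 L)// ?(ltW L0)// mulrA (@powRM _ (2 * _)) ?mulr_ge0 ?powR_ge0//.
by rewrite -(powRrM L) mulrBr mulr1 mulrA mulVf ?gt_eqF// mul1r.
Qed.

End Torus.

(** * Dyadic blocks *)

Section Blocks.
Context {R : realType} (phi0 phi1 : R -> R).
Hypothesis hphi : dyadic_partition phi0 phi1.
Implicit Types (f g : periodic_distribution R).

Lemma phi_support (j : nat) x : 4 * 2 ^+ j < `|x| -> phi_ phi0 phi1 j x = 0.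
Proof.
case: hphi => _ _ _ _ s0 s1 _ jx.
have p2 i : (0 : R) < 2 ^+ i by rewrite exprn_gt0.
case: j jx => [|j] jx /=; apply/eqP; apply: contraTT jx; rewrite -leNgt => nz.
  have : closure [set x | phi0 x != 0] x by exact: subset_closure.
  by move=> /s0/= /le_trans; apply; rewrite expr0; lra.
have : closure [set x | phi1 x != 0] (x / 2 ^+ j) by exact: subset_closure.
move=> /s1 /= /andP[_].
rewrite normrM normfV (ger0_norm (ltW (p2 j))) ler_pdivrMr// => /le_trans; apply.
by rewrite exprS; have := p2 j; lra.
Qed.

(** [phi_j] vanishes at the integers [k] with [|k| > 4 * 2 ^ j]. *)
Lemma dyadic_blockE f j x : dyadic_block phi0 phi1 f j x =
  trigpoly (4 * 2 ^ j) (fun i : 'I_((4 * 2 ^ j).*2.+1) =>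
    (phi_ phi0 phi1 j (i%:Z - (4 * 2 ^ j)%N%:Z)%:~R)%:C *
    fourier_coef f (i%:Z - (4 * 2 ^ j)%N%:Z)) x.
Proof.
rewrite /dyadic_block /trigpoly; set K := (4 * 2 ^ j)%N.
have out (k : int) : k \notin [seq i%:Z - K%:Z | i <- iota 0 K.*2.+1] ->
    phi_ phi0 phi1 j k%:~R = 0.
  move=> kr; rewrite phi_support// -intr_norm -abszE -(natrX _ 2 j) -natrM.
  rewrite ltr_nat ltnNge; apply: contra kr => kK.
  apply/mapP; exists (absz (k + K%:Z)%R); first by rewrite mem_iota; lia.
  by lia.
rewrite (fsbigE [seq i%:Z - K%:Z | i <- iota 0 K.*2.+1]).
- rewrite big_map (eq_bigl xpredT); last by move=> i; rewrite in_setT.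
  by rewrite -[X in iota 0 X]subn0 -/(index_iota 0 _) big_mkord.
- by rewrite map_inj_uniq ?iota_uniq// => a b /addIr[].
- by [].
- by move=> k _ /out ->; rewrite !mul0r.
Qed.

Lemma fourier_coefZ f (l : R[i]) k : fourier_coef (l *: f) k = l * fourier_coef f k.
Proof. by []. Qed.

Lemma fourier_coefD f g k :
  fourier_coef (f + g) k = fourier_coef f k + fourier_coef g k.
Proof. by []. Qed.

Lemma dyadic_blockZ f (l : R[i]) j x :
  dyadic_block phi0 phi1 (l *: f) j x = l * dyadic_block phi0 phi1 f j x.
Proof.
rewrite !dyadic_blockE /trigpoly mulr_sumr; apply: eq_bigr => i _.
by rewrite fourier_coefZ !mulrA (mulrC _ l).
Qed.

Lemma dyadic_blockD f g j x : dyadic_block phi0 phi1 (f + g) j x =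
  dyadic_block phi0 phi1 f j x + dyadic_block phi0 phi1 g j x.
Proof.
rewrite !dyadic_blockE /trigpoly -big_split; apply: eq_bigr => i _.
by rewrite fourier_coefD mulrDr mulrDl.
Qed.

Definition block_modulus f j x := normc (dyadic_block phi0 phi1 f j x).

(** With [N = 4 * 2 ^ j], this dominates [(2 N + 1) * (4 * pi * N)], the
    constant of the Bernstein inequality for the [j]-th block. *)
Definition block_lipschitz j : R := 144 * pi * 4 ^+ j.

Lemma block_lipschitz_ge1 j : 1 <= block_lipschitz j.
Proof.
rewrite /block_lipschitz; have p4 : (1 : R) <= 4 ^+ j by rewrite exprn_ege1//; lra.
by have := pi_ge2 R; nra.
Qed.

(** The Bernstein bound needs an upper bound of the modulus. It is used first
    with the sum of the moduli of the coefficients, which gives continuity,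
    hence the existence of a maximum, and then with this maximum. *)
Lemma block_modulus_peak f j :
  exists A, lipschitz_peak (block_lipschitz j) A (block_modulus f j).
Proof.
set K := (4 * 2 ^ j)%N.
pose c := fun i : 'I_(K.*2.+1) => (phi_ phi0 phi1 j (i%:Z - K%:Z)%:~R)%:C *
    fourier_coef f (i%:Z - K%:Z).
have uE x : block_modulus f j x = normc (trigpoly K c x).
  by rewrite /block_modulus dyadic_blockE.
have u0 x : 0 <= block_modulus f j x.
  by rewrite /block_modulus; case: dyadic_block => a b; exact: sqrtr_ge0.
have lip A : (forall x, 0 <= x <= 1 -> block_modulus f j x <= A) ->
  forall x y, `|block_modulus f j x - block_modulus f j y| <=
    block_lipschitz j * A * `|x - y|.
  move=> uA x y; rewrite !uE.
  have A0 : 0 <= A by apply: le_trans (u0 0) (uA _ _); rewrite lexx ler01.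
  have := @trigpoly_lipschitz R _ K c A (leqnn _).
  have TA t : 0 <= t <= 1 -> normc (trigpoly K c t) <= A by rewrite -uE; exact: uA.
  move=> /(_ TA x y) /le_trans; apply.
  rewrite !ler_wpM2r// /block_lipschitz.
  have e2 : (4 : R) ^+ j = 2 ^+ j * 2 ^+ j by rewrite -exprMn; congr (_ ^+ _); ring.
  have p1 : (1 : R) <= 2 ^+ j by rewrite exprn_ege1//; lra.
  have := pi_ge0 R; set q := pi; move=> q0.
  have KE : K%:R = 4 * 2 ^+ j :> R by rewrite /K natrM natrX.
  rewrite -addn1 -muln2 natrD natrM KE e2.
  set w := 2 ^+ j in p1 *.
  have -> : (4 * w * 2 + 1) * (4 * q * (4 * w)) = q * (16 * (8 * w + 1) * w) by ring.
  have -> : 144 * q * (w * w) = q * (144 * w * w) by ring.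
  by rewrite ler_wpM2l//; nra.
have crude x : 0 <= x <= 1 -> block_modulus f j x <= \sum_i normc (c i).
  move=> _; rewrite uE /trigpoly; apply: le_trans (normc_sum _) _.
  by apply: ler_sum => i _; rewrite normcM normc_expi mulr1.
have cu : {within `[(0 : R), 1], continuous (block_modulus f j)}.
  exact: continuous_subspaceT (lipschitz_continuous (lip _ crude)).
have [z z01 zmax] := EVT_max (@ler01 R) cu.
exists (block_modulus f j z); split => //.
- by exists z; first by move: z01; rewrite in_itv.
- by apply: lip => x x01; apply: zmax; rewrite in_itv.
Qed.

End Blocks.

(** * Besov spaces and critical smoothness *)

Section WeightedSequences.
Context {R : realType}.
Local Open Scope ereal_scope.

Lemma nneseries_dominate (x y z : nat -> \bar R) (C r : R) :
  (0 < r)%R -> (0 <= C)%R ->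
  (forall j, 0 <= x j) -> (forall j, 0 <= y j) -> (forall j, 0 <= z j) ->
  (forall j, z j <= C%:E * maxe (x j) (y j)) ->
  \sum_(0 <= j <oo) x j `^ r < +oo -> \sum_(0 <= j <oo) y j `^ r < +oo ->
  \sum_(0 <= j <oo) z j `^ r < +oo.
Proof.
move=> r0 C0 x0 y0 z0 zC xoo yoo.
apply: (@le_lt_trans _ _ (\sum_(0 <= j <oo) ((C `^ r)%:E * (x j `^ r + y j `^ r)))).
  apply: lee_nneseries => [j _ _|j _]; first exact: poweR_ge0.
  apply: (@le_trans _ _ ((C%:E * maxe (x j) (y j)) `^ r)).
    apply: gt0_ler_poweR; rewrite ?(ltW r0)// in_itv/= leey andbT//.
    by rewrite mule_ge0// le_max x0.
  rewrite poweRM//; last by rewrite le_max x0.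
  rewrite poweR_EFin lee_wpmul2l ?lee_fin ?powR_ge0//.
  by rewrite /maxe; case: ifP => _; [rewrite leeDr|rewrite leeDl]; rewrite ?poweR_ge0.
rewrite nneseriesZl; last by move=> j _; rewrite adde_ge0 ?poweR_ge0.
rewrite lte_mul_pinfty ?lee_fin ?powR_ge0//.
by rewrite nneseriesD ?lte_add_pinfty// => j _ _; exact: poweR_ge0.
Qed.

End WeightedSequences.

Section CriticalSmoothness.
Context {R : realType} (phi0 phi1 : R -> R).
Hypothesis hphi : dyadic_partition phi0 phi1.
Variable q : \bar R.
Hypothesis hq : (0 < q)%E.
Implicit Types (f g : periodic_distribution R) (s p r : R) (P : \bar R).

Local Notation B s P f := (besov_space phi0 phi1 s P q f).
Local Notation S f P := (critical_smoothness phi0 phi1 q f P).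
Local Notation bn P f j := (block_norm phi0 phi1 P f j).
Local Notation u f j := (block_modulus phi0 phi1 f j).

Lemma block_normE P f j :
  bn P f j = Lnorm (torus_measure R) P (fun x => (u f j x)%:E).
Proof. by []. Qed.

Lemma block_norm_ge0 P f j : (0 <= bn P f j)%E.
Proof. exact: Lnorm_ge0. Qed.

(** All the inclusions between Besov spaces used below are instances: the
    weighted block norms are compared scale by scale, and membership only
    depends on the size of the resulting sequence in [l^q]. *)
Lemma besov_dominate (C s s1 s2 : R) (P P1 P2 : \bar R) f f1 f2 : 0 <= C ->
  (forall j, (2 `^ (j%:R * s))%:E * bn P f j <= C%:E *
    maxe ((2 `^ (j%:R * s1))%:E * bn P1 f1 j)
      ((2 `^ (j%:R * s2))%:E * bn P2 f2 j))%E ->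
  B s1 P1 f1 -> B s2 P2 f2 -> B s P f.
Proof.
move=> C0 dom; rewrite /besov_space /besov_norm /=.
case: q hq => [r| |//]; last first.
  move=> _ H1 H2; set M1 := ereal_sup _ in H1; set M2 := ereal_sup _ in H2.
  have M12 : (0 <= maxe M1 M2)%E.
    rewrite le_max; apply/orP; left.
    apply: (@le_trans _ _ ((2 `^ (0%:R * s1))%:E * bn P1 f1 0)%E).
      by rewrite mule_ge0 ?lee_fin ?powR_ge0 ?block_norm_ge0.
    by apply: ereal_sup_ubound; exists 0%N.
  apply: (@le_lt_trans _ _ (C%:E * maxe M1 M2)%E).
    apply: ge_ereal_sup => _ [j _ <-]; apply: le_trans (dom j) _.
    rewrite lee_wpmul2l ?lee_fin// ge_max !le_max; apply/andP; split; apply/orP.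
      by left; apply: ereal_sup_ubound; exists j.
    by right; apply: ereal_sup_ubound; exists j.
  by rewrite lte_mul_pinfty ?lee_fin// gt_max H1 H2.
rewrite lte_fin => r0.
have E s' P' f' : (\sum_(0 <= j <oo) (2 `^ (j%:R * s' * r))%:E * bn P' f' j `^ r =
    \sum_(0 <= j <oo) ((2 `^ (j%:R * s'))%:E * bn P' f' j) `^ r)%E.
  apply: eq_eseriesr => j _; rewrite poweRM ?lee_fin ?powR_ge0 ?block_norm_ge0//.
  by rewrite poweR_EFin -powRrM.
rewrite !E => /lty_poweRy H1 /lty_poweRy H2; apply: poweR_lty.
apply: (nneseries_dominate r0 C0 _ _ _ dom (H1 _) (H2 _)) => [j|j|j||];
  by rewrite ?mule_ge0 ?lee_fin ?powR_ge0 ?block_norm_ge0// invr_neq0// gt_eqF.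
Qed.

Lemma besov_dominate1 (C s s1 : R) (P P1 : \bar R) f f1 : 0 <= C ->
  (forall j, (2 `^ (j%:R * s))%:E * bn P f j <=
    C%:E * ((2 `^ (j%:R * s1))%:E * bn P1 f1 j))%E ->
  B s1 P1 f1 -> B s P f.
Proof.
move=> C0 dom H; apply: (besov_dominate C0 _ H H) => j.
by rewrite maxxx.
Qed.

Lemma besov_decr s s' P f : s <= s' -> B s' P f -> B s P f.
Proof.
move=> ss'; apply: (@besov_dominate1 1) => // j.
rewrite mul1e lee_wpmul2r ?block_norm_ge0// lee_fin ler_powR ?ler1n//.
by rewrite ler_wpM2l.
Qed.

Lemma besov_le_critical s P f : B s P f -> (s%:E <= S f P)%E.
Proof. by move=> Bs; apply: ereal_sup_ubound; exists s. Qed.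

Lemma lt_critical_besov s P f : (s%:E < S f P)%E -> B s P f.
Proof.
move=> /ereal_sup_gt[_ [s' Bs' <-]]; rewrite lte_fin => /ltW ss'.
exact: besov_decr Bs'.
Qed.

Lemma critical_le_shift f f' P P' (d : R) :
  (forall s, B s P f -> B (s - d) P' f') -> (S f P <= S f' P' + d%:E)%E.
Proof.
move=> H; apply: ge_ereal_sup => _ [s Bs <-]; rewrite -leeBlDr// -EFinB.
exact: besov_le_critical (H _ Bs).
Qed.

Lemma block_normZ_le P f (l : R[i]) : (0 < P)%E -> exists2 C : R, 0 <= C &
  forall j, (bn P (l *: f) j <= C%:E * bn P f j)%E.
Proof.
move=> P0; have l0 : 0 <= normc l by case: l => a b; exact: sqrtr_ge0.
have [C C0 HC] := Lnorm_quasi_triangle (torus_measure R) P0 l0.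
exists C => // j; rewrite !block_normE.
have [A [v0 _ _ lip]] := block_modulus_peak hphi f j.
have [A' [w0 _ _ lip']] := block_modulus_peak hphi (l *: f) j.
have mv := measurable_lipschitz lip.
have mw := measurable_lipschitz lip'.
have := HC _ _ _ mv mv mw v0 v0 w0; rewrite maxxx; apply => x.
rewrite /block_modulus dyadic_blockZ// normcM ler_wpM2l// lerDl; exact: v0.
Qed.

Lemma block_normD_le P f g : (0 < P)%E -> exists2 C : R, 0 <= C &
  forall j, (bn P (f + g)%R j <= C%:E * maxe (bn P f j) (bn P g j))%E.
Proof.
move=> P0; have [C C0 HC] := Lnorm_quasi_triangle (torus_measure R) P0 ler01.
exists C => // j; rewrite !block_normE.
have [A [v0 _ _ lip]] := block_modulus_peak hphi f j.
have [A' [w0 _ _ lip']] := block_modulus_peak hphi g j.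
have [A'' [z0 _ _ lip'']] := block_modulus_peak hphi (f + g) j.
have mv := measurable_lipschitz lip.
have mw := measurable_lipschitz lip'.
have mz := measurable_lipschitz lip''.
apply: HC => // x.
by rewrite mul1r /block_modulus dyadic_blockD//; exact: le_normcD.
Qed.

Lemma critical_scale_le P f (l : R[i]) : (0 < P)%E -> (S f P <= S (l *: f) P)%E.
Proof.
move=> P0; rewrite -[leRHS]adde0; apply: critical_le_shift => s Bs.
have [C C0 HC] := block_normZ_le f l P0.
rewrite subr0; apply: besov_dominate1 C0 _ Bs => j.
by rewrite muleCA lee_wpmul2l ?lee_fin ?powR_ge0.
Qed.

Lemma critical_scale P f (l : R[i]) : (0 < P)%E -> l != 0 -> S (l *: f) P = S f P.
Proof.
move=> P0 l0; apply/eqP; rewrite eq_le; apply/andP; split.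
  have := critical_scale_le (l *: f) l^-1 P0.
  by rewrite scalerA mulVf// scale1r.
exact: critical_scale_le.
Qed.

(** A smoothness [s] reached by [f] need not be reached by [g] when
    [s_f = s_g], hence the loss of an arbitrary [e]. *)
Lemma critical_add_ge P f g : (0 < P)%E -> (mine (S f P) (S g P) <= S (f + g)%R P)%E.
Proof.
move=> P0; wlog fg : f g / (S f P <= S g P)%E.
  move=> H; case/orP: (le_total (S f P) (S g P)) => [/H//|/H].
  by rewrite minC addrC.
rewrite min_l//; apply: ge_ereal_sup => _ [s Bs <-].
apply/lee_addgt0Pr => e e0; rewrite -leeBlDr// -EFinB.
apply: besov_le_critical.
have Bf : B (s - e) P f by apply: besov_decr Bs; rewrite gerBl ltW.
have Bg : B (s - e) P g.
  apply: lt_critical_besov; apply: lt_le_trans fg.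
  apply: lt_le_trans (besov_le_critical Bs).
  by rewrite lte_fin gtrBl.
have [C C0 HC] := block_normD_le f g P0.
apply: besov_dominate C0 _ Bf Bg => j.
rewrite -maxe_pMr ?fin_numE ?lee_fin ?powR_ge0//.
by rewrite muleCA lee_wpmul2l ?lee_fin ?powR_ge0.
Qed.

(** If [s_f < s_g] and [s_(f+g) > s_f], then [f = (f + g) - g] would be
    smoother than [s_f]. *)
Lemma critical_add_neq P f g : (0 < P)%E -> S f P <> S g P ->
  S (f + g) P = mine (S f P) (S g P).
Proof.
move=> P0; wlog fg : f g / (S f P < S g P)%E.
  move=> H neq; have [fg|gf|//] := ltgtP (S f P) (S g P).
    by rewrite H// (min_l (ltW fg)).
  by rewrite addrC H ?(min_l (ltW gf))//; exact: nesym.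
move=> _; rewrite (min_l (ltW fg)); apply/eqP; rewrite eq_le; apply/andP; split; last first.
  by have := critical_add_ge f g P0; rewrite (min_l (ltW fg)).
have := critical_add_ge (f + g) (- g) P0; rewrite addrK.
rewrite -[- g]scaleN1r critical_scale ?oppr_eq0 ?oner_eq0//.
by rewrite ge_min => /orP[//|]; rewrite leNgt fg.
Qed.

(** The torus has measure [1], so the block norms increase with the
    exponent. *)
Lemma critical_anti p P f : 0 < p -> (p%:E < P)%E -> (S f P <= S f p%:E)%E.
Proof.
move=> p0 pP; rewrite -[leRHS]adde0; apply: critical_le_shift => s Bs.
rewrite subr0; apply: (@besov_dominate1 1) Bs => // j.
rewrite mul1e lee_wpmul2l ?lee_fin ?powR_ge0// !block_normE.
have [A [v0 _ _ lip]] := block_modulus_peak hphi f j.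
apply: Lnorm_le_exponent => //; first exact: torus_measureT.
exact: measurable_lipschitz lip.
Qed.

(** Sobolev embedding with a loss of [2 (1/p - 1/P)] derivatives: the
    factor [2] comes from the Lipschitz constant [O(4 ^ j) = O(2 ^ (2 j))] of
    the blocks. *)
Lemma critical_sobolev p P f : 0 < p -> (p%:E < P)%E ->
  (S f p%:E <= S f P + (2 * (p^-1 - fine P^-1))%:E)%E.
Proof.
move=> p0 pP; set d := p^-1 - _; apply: critical_le_shift => s Bs.
have [C C0 HC] := @peak_Lnorm_reverse R p P p0 pP.
apply: (@besov_dominate1 (C * (144 * pi) `^ d)) Bs.
  by rewrite mulr_ge0 ?powR_ge0.
move=> j; rewrite !block_normE.
have [A uA] := block_modulus_peak hphi f j.
have := HC _ _ _ (block_lipschitz_ge1 j) uA; rewrite -/d => H.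
apply: le_trans (lee_wpmul2l _ H) _; first by rewrite lee_fin powR_ge0.
rewrite !muleA -!EFinM lee_wpmul2r ?Lnorm_ge0// lee_fin /block_lipschitz.
rewrite powRM ?mulr_ge0 ?pi_ge0 ?exprn_ge0//.
have -> : ((4 : R) ^+ j) `^ d = 2 `^ (j%:R * (2 * d)).
  rewrite -powR_mulrn// -powRrM (_ : 4 = 2 `^ 2%:R); last by rewrite powR_mulrn//; ring.
  by rewrite -powRrM; congr (_ `^ _); ring.
rewrite mulrBr powRB ?pnatr_eq0 ?implybT//.
set a := 2 `^ (j%:R * (2 * d)).
have a0 : a != 0 by rewrite gt_eqF// powR_gt0.
by rewrite le_eqVlt; apply/orP; left; apply/eqP; field.
Qed.

End CriticalSmoothness.

(** * Comparing nearby exponents *)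

Section Countable.
Context {R : realType}.

Lemma uncountable_itvoo (a b : R) : a < b -> ~ countable `]a, b[%classic.
Proof.
move=> ab /countable_lebesgue_measure0.
rewrite lebesgue_measure_itv/= lte_fin ab -EFinB => /eqP.
by rewrite eqe subr_eq0 gt_eqF.
Qed.

(** Exponents with [r^-1 < 1/P + e] fill a nondegenerate interval below [P],
    and a countable set cannot contain it. *)
Lemma cocountable_exponent (E : set (\bar R)) (P : \bar R) (e : R) :
  countable E -> (0 < P)%E -> 0 < e ->
  exists2 r : R, 0 < r & [/\ (r%:E < P)%E, r^-1 - fine P^-1 <= e & ~ E r%:E].
Proof.
move=> cE P0 e0; set i := fine P^-1.
have i0 : 0 <= i.
  by rewrite fine_ge0// inve_ge0 ltW.
have ie0 : 0 < i + e by rewrite ltr_wpDl.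
(* b = P works when P is finite; any b > (i + e)^-1 does otherwise *)
have [b ab bP] : exists2 b : R, (i + e)^-1 < b & (b%:E <= P)%E.
  rewrite {}/i in i0 ie0 *; case: P P0 i0 ie0 => [p||]//.
    rewrite lte_fin => p0; rewrite inver gt_eqF//= => i0 ie0.
    by exists p => //; rewrite invf_plt ?posrE// ltrDl.
  by move=> _ _ _; exists ((fine +oo^-1 + e)^-1 + 1); rewrite ?ltrDl// leey.
have : ~ `](i + e)^-1, b[%classic `<=` [set r : R | E r%:E].
  move=> sub; apply: (uncountable_itvoo ab).
  apply: sub_countable (subset_card_le sub) _.
  have -> : [set r : R | E r%:E] = EFin @^-1` E by [].
  apply/countable_injP; have /countable_injP[h hinj] := cE.
  exists (h \o EFin) => x y; rewrite !inE => Ex Ey /= hxy.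
  by have [] := hinj x%:E y%:E (mem_set Ex) (mem_set Ey) hxy.
move=> /nonsubset[r [/=]]; rewrite in_itv/= => /andP[ar rb] nE.
have r0 : 0 < r by apply: lt_trans ar; rewrite invr_gt0.
exists r => //; split => //.
- by apply: lt_le_trans bP; rewrite lte_fin.
- by rewrite lerBlDl; apply: ltW; rewrite invf_plt ?posrE.
Qed.

End Countable.

Section Continuity.
Context {R : realType} (phi0 phi1 : R -> R).
Hypothesis hphi : dyadic_partition phi0 phi1.
Variable q : \bar R.
Hypothesis hq : (0 < q)%E.
Implicit Types (f g : periodic_distribution R) (P : \bar R).
Local Notation S f P := (critical_smoothness phi0 phi1 q f P).

(** The formula holds at exponents [r < P] as close to [P] as desired. Going
    down from [P] to [r] costs nothing on the left-hand side, and coming back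
    from [r] to [P] costs at most [e] on the right-hand side. *)
Lemma critical_add_cocountable f g :
  countable [set P : \bar R | (0 < P)%E /\ S f P = S g P] ->
  forall P, (0 < P)%E -> S (f + g) P = mine (S f P) (S g P).
Proof.
move=> cfg P P0; apply/eqP; rewrite eq_le critical_add_ge// andbT.
apply/lee_addgt0Pr => e e0.
have e20 : 0 < e / 2 by rewrite divr_gt0.
have [r r0 [rP re nE]] := cocountable_exponent cfg P0 e20.
have re0 : (0 < r%:E)%E by rewrite lte_fin.
have neq : S f r%:E <> S g r%:E by move=> E; apply: nE.
have near h : (S h r%:E <= S h P + e%:E)%E.
  apply: le_trans (critical_sobolev hphi hq h r0 rP) _.
  by rewrite leeD2l// lee_fin mulrC -ler_pdivlMr.
apply: le_trans (critical_anti hphi hq (f + g) r0 rP) _.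
rewrite critical_add_neq// /mine.
by case: (ltP (S f P)) => _; rewrite ge_min; apply/orP; [left|right]; exact: near.
Qed.

End Continuity.

Theorem proposition4p4 (R : realType) (phi0 phi1 : R -> R)
    (hphi : dyadic_partition phi0 phi1) (q : \bar R) (hq : (0 < q)%E)
    (f g : periodic_distribution R) (lambda : R[i]) (hlambda : lambda != 0) :
  let s_ := critical_smoothness phi0 phi1 q in
  [/\ forall p : \bar R, (0 < p)%E -> s_ (lambda *: f) p = s_ f p,
      forall p : \bar R, (0 < p)%E -> s_ f p <> s_ g p ->
        s_ (f + g) p = Order.min (s_ f p) (s_ g p)
    & countable [set p : \bar R | (0 < p)%E /\ s_ f p = s_ g p] ->
      forall p : \bar R, (0 < p)%E ->
        s_ (f + g) p = Order.min (s_ f p) (s_ g p)].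
Proof.
move=> s_; split.
- by move=> p p0; exact: critical_scale.
- by move=> p p0; exact: critical_add_neq.
- exact: critical_add_cocountable.
Qed.
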